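(* If $R$ is a commutative Noetherian ring, the category of finitely generated FI-modules over $R$ is an abelian category.
   Context: Let $\mathrm{FI}$ be the category whose objects are finite sets and whose morphisms are injections; $[n]=\{1,\dots,n\}$, $[0]=\emptyset$. For a commutative ring $R$, an FI-module over $R$ is a covariant functor $V$ from $\mathrm{FI}$ to the category of $R$-modules; write $V_S=V(S)$, $V_n=V([n])$, and $f_*=V(f)$ for an injection $f$. Morphisms of FI-modules are natural transformations, and the category of finitely generated FI-modules is the full subcategory on the finitely generated objects. A sub-FI-module $W\subset V$ is a collection of $R$-submodules $W_S\subset V_S$, one for each finite set $S$, with $f_*(W_S)\subset W_T$ for every injection $f\colon S\to T$. An FI-module $V$ is finitely generated if there is a finite subset of $\coprod_{n\ge 0}V_n$ that is not contained in any proper sub-FI-module of $V$. *)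

(* Defs.v *)
From HB Require Import structures.
From mathcomp Require Import all_boot all_algebra.
From mathcomp Require Import boolp classical_sets cardinality.

Set Implicit Arguments.
Unset Strict Implicit.
Unset Printing Implicit Defensive.

Import GRing.Theory.

Local Open Scope classical_set_scope.
Local Open Scope ring_scope.

Record category := Category {
  obj :> Type;
  mor : obj -> obj -> Type;
  idmor : forall X, mor X X;
  mcomp : forall X Y Z, mor Y Z -> mor X Y -> mor X Z;
  mcompA : forall X Y Z W (h : mor Z W) (g : mor Y Z) (f : mor X Y),
    mcomp h (mcomp g f) = mcomp (mcomp h g) f;
  mcomp1m : forall X Y (f : mor X Y), mcomp (idmor Y) f = f;
  mcompm1 : forall X Y (f : mor X Y), mcomp f (idmor X) = f }.

Arguments idmor {c} X.

Notation "g \mc f" := (mcomp g f) (at level 50, format "g  \mc  f").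

Record functor (C D : category) := Functor {
  fobj :> C -> D;
  fctmap : forall X Y : C, mor X Y -> mor (fobj X) (fobj Y);
  fctmap1 : forall X : C, fctmap (idmor X) = idmor (fobj X);
  fctmapM : forall (X Y Z : C) (g : mor Y Z) (f : mor X Y),
    fctmap (g \mc f) = fctmap g \mc fctmap f }.

Arguments fctmap {C D} F {X Y} f : rename.

Record nattrans (C D : category) (F G : functor C D) := NatTrans {
  ntapp :> forall X : C, mor (F X) (G X);
  ntnat : forall (X Y : C) (f : mor X Y),
    fctmap G f \mc ntapp X = ntapp Y \mc fctmap F f }.

Section FunctorCategory.
Variables C D : category.

Lemma nattrans_eq (F G : functor C D) (s t : nattrans F G) :
  (forall X, s X = t X) -> s = t.
Proof.
case: s t => s sN [t tN] /= st; have e : s = t by exact/functional_extensionality_dep.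
by subst t; congr NatTrans; exact: Prop_irrelevance.
Qed.

Fact nt_id_nat (F : functor C D) (X Y : C) (f : mor X Y) :
  fctmap F f \mc idmor (F X) = idmor (F Y) \mc fctmap F f.
Proof. by rewrite mcompm1 mcomp1m. Qed.

Definition nt_id F := NatTrans (@nt_id_nat F).

Fact nt_comp_nat (F G H : functor C D) (t : nattrans G H) (s : nattrans F G)
    (X Y : C) (f : mor X Y) :
  fctmap H f \mc (t X \mc s X) = (t Y \mc s Y) \mc fctmap F f.
Proof. by rewrite mcompA ntnat -mcompA ntnat mcompA. Qed.

Definition nt_comp F G H (t : nattrans G H) (s : nattrans F G) :=
  NatTrans (nt_comp_nat t s).

Definition functor_category : category.
Proof.
refine (@Category (functor C D) (@nattrans C D) nt_id nt_comp _ _ _).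
- by move=> *; apply: nattrans_eq => X /=; rewrite mcompA.
- by move=> *; apply: nattrans_eq => X /=; rewrite mcomp1m.
- by move=> *; apply: nattrans_eq => X /=; rewrite mcompm1.
Defined.

End FunctorCategory.

Definition full_subcategory (C : category) (P : C -> Prop) : category :=
  @Category {X : C | P X}
    (fun X Y => mor (sval X) (sval Y))
    (fun X => idmor (sval X))
    (fun X Y Z => @mcomp C (sval X) (sval Y) (sval Z))
    (fun X Y Z W => @mcompA C (sval X) (sval Y) (sval Z) (sval W))
    (fun X Y => @mcomp1m C (sval X) (sval Y))
    (fun X Y => @mcompm1 C (sval X) (sval Y)).

Record preadditive (C : category) := Preadditive {
  madd : forall X Y : C, mor X Y -> mor X Y -> mor X Y;
  mzero : forall X Y : C, mor X Y;
  mopp : forall X Y : C, mor X Y -> mor X Y;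
  maddA : forall X Y, associative (@madd X Y);
  maddC : forall X Y, commutative (@madd X Y);
  madd0 : forall X Y, left_id (mzero X Y) (@madd X Y);
  maddN : forall X Y, left_inverse (mzero X Y) (@mopp X Y) (@madd X Y);
  mcompDl : forall X Y Z (g g' : mor Y Z) (f : mor X Y),
    madd g g' \mc f = madd (g \mc f) (g' \mc f);
  mcompDr : forall X Y Z (g : mor Y Z) (f f' : mor X Y),
    g \mc madd f f' = madd (g \mc f) (g \mc f') }.

Arguments mzero {C} p X Y.

Section Abelian.
Variable C : category.

Definition monomorphism (X Y : C) (f : mor X Y) :=
  forall (T : C) (u v : mor T X), f \mc u = f \mc v -> u = v.

Definition epimorphism (X Y : C) (f : mor X Y) :=
  forall (T : C) (u v : mor Y T), u \mc f = v \mc f -> u = v.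

Definition zero_object (Z : C) :=
  forall X : C, (exists! f : mor X Z, True) /\ (exists! f : mor Z X, True).

Variable A : preadditive C.

Definition is_kernel (X Y K : C) (f : mor X Y) (k : mor K X) :=
  f \mc k = mzero A K Y /\
  forall (T : C) (u : mor T X), f \mc u = mzero A T Y ->
    exists! v : mor T K, k \mc v = u.

Definition is_cokernel (X Y Q : C) (f : mor X Y) (q : mor Y Q) :=
  q \mc f = mzero A X Q /\
  forall (T : C) (u : mor Y T), u \mc f = mzero A X T ->
    exists! v : mor Q T, v \mc q = u.

Definition is_biproduct (X Y P : C)
    (i1 : mor X P) (i2 : mor Y P) (p1 : mor P X) (p2 : mor P Y) :=
  [/\ p1 \mc i1 = idmor X, p2 \mc i2 = idmor Y,
      p1 \mc i2 = mzero A Y X, p2 \mc i1 = mzero A X Y &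
      madd A (i1 \mc p1) (i2 \mc p2) = idmor P].

Definition abelian_for :=
  [/\ exists Z : C, zero_object Z,
      forall X Y : C, exists (P : C) (i1 : mor X P) (i2 : mor Y P)
        (p1 : mor P X) (p2 : mor P Y), is_biproduct i1 i2 p1 p2,
      forall (X Y : C) (f : mor X Y),
        (exists (K : C) (k : mor K X), is_kernel f k) /\
        (exists (Q : C) (q : mor Y Q), is_cokernel f q),
      forall (X Y : C) (f : mor X Y), monomorphism f ->
        exists (Z : C) (g : mor Y Z), is_kernel g f &
      forall (X Y : C) (f : mor X Y), epimorphism f ->
        exists (Z : C) (g : mor Z X), is_cokernel g f].

End Abelian.

(* The additive structure of an abelian category is unique, so that being
   abelian is a property of the bare category. *)
Definition abelian_category (C : category) :=
  exists A : preadditive C, abelian_for A.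

Definition FI : category.
Proof.
refine (@Category finType (fun S T => {f : S -> T | injective f})
  (fun S => exist _ id (@inj_id S))
  (fun S T U g f => exist _ (sval g \o sval f) (inj_comp (svalP g) (svalP f)))
  _ _ _).
- by move=> *; exact: eq_exist.
- by move=> S T [f fI]; exact: eq_exist.
- by move=> S T [f fI]; exact: eq_exist.
Defined.

Lemma linear_eqP (R : pzRingType) (U V : lmodType R) (f g : {linear U -> V}) :
  f =1 g -> f = g.
Proof.
case: f g => f [[fa] [fs]] [g [[ga] [gs]]] /= /funext fg; subst g.
by rewrite (Prop_irrelevance fa ga) (Prop_irrelevance fs gs).
Qed.

Definition Mod (R : pzRingType) : category.
Proof.
refine (@Category (lmodType R) (fun U V => {linear U -> V})
  (fun U => idfun : {linear U -> U})
  (fun U V W g f => (g \o f : {linear U -> W}))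
  _ _ _); by move=> *; exact: linear_eqP.
Defined.

Definition FImodule (R : comPzRingType) := functor FI (Mod R).

Definition fi_space (R : comPzRingType) (V : FImodule R) (S : finType) :
  lmodType R := V S.

Definition fi_map (R : comPzRingType) (V : FImodule R) (S T : finType)
    (f : S -> T) (fI : injective f) : {linear fi_space V S -> fi_space V T} :=
  fctmap V (exist _ f fI : @mor FI S T).

Record subFImodule (R : comPzRingType) (V : FImodule R) := SubFImodule {
  subfi :> forall S : finType, set (fi_space V S);
  subfi_submod : forall S, submod_closed [in @subfi S];
  subfi_map : forall (S T : finType) (f : S -> T) (fI : injective f),
    fi_map V fI @` @subfi S `<=` @subfi T }.

Arguments subfi {R V} W S : rename.

Definition proper_subFImodule (R : comPzRingType) (V : FImodule R)
    (W : subFImodule V) :=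
  exists S : finType, W S <> setT.

(* [n] is rendered by 'I_n, and the elements of the disjoint union of the V_n
   by pairs [existT _ n v] with [v] in [V_n]. *)
Definition finitely_generated_FImodule (R : comPzRingType) (V : FImodule R) :=
  exists2 X : set {n : nat & fi_space V 'I_n}, finite_set X &
    ~ exists2 W : subFImodule V, proper_subFImodule W &
        forall x, X x -> W 'I_(projT1 x) (projT2 x).

Definition FGFIMod (R : comPzRingType) : category :=
  @full_subcategory (functor_category FI (Mod R))
    (@finitely_generated_FImodule R).

(* Ideals are the submodules of the regular module [R^o]. *)
Definition noetherian (R : comPzRingType) :=
  forall I : set R^o, submod_closed [in I] ->
    exists (n : nat) (a : 'I_n -> R),
      I = [set x | exists c : 'I_n -> R, x = \sum_(i < n) c i * a i].

(* Main.v *)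
(** Only the existence of kernels uses that [R] is Noetherian: it amounts to
    sub-FI-modules of finitely generated FI-modules being finitely generated.
    The argument for this is a Groebner basis one.  If [V] is generated by
    [v i] in [V_(d i)], then [V_S] is spanned by the monomials [f_* (v i)] with
    [f] an injection from ['I_(d i)] to [S].  Order the monomials of ['I_n]
    lexicographically; increasing injections preserve this order.  If [W] were
    not finitely generated, one could choose successively elements of [W] outside
    the sub-FI-module generated by the previous ones, each with least possible
    leading monomial in its degree.  By Dickson's lemma, along a subsequence
    every leading monomial is the image of all the preceding ones under
    increasing injections; as [R] is Noetherian, some leading coefficient is a
    combination of the preceding ones, and cancelling the leading term
    contradicts minimality. *)

From HB Require Import structures.
Require Import Defs.
From mathcomp Require Import all_boot all_order all_algebra.
From mathcomp Require Import generic_quotient ring_quotient.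
From mathcomp Require Import boolp classical_sets cardinality.
From mathcomp Require Import zify.

Set Implicit Arguments.
Unset Strict Implicit.
Unset Printing Implicit Defensive.

Import Order.TTheory GRing.Theory.

Local Open Scope classical_set_scope.
Local Open Scope ring_scope.
Local Open Scope quotient_scope.

(** * Submodules and quotients of modules and of FI-modules *)

Section Submodule.
Variables (R : pzRingType) (V : lmodType R) (W : set V).

(** The closure proof is a phantom argument: it lets the submodule structure be inferred from the
    predicate alone. *)
Definition submod_pred (_ : submod_closed [in W]) : {pred V} := [in W].

Hypothesis W_closed : submod_closed [in W].

HB.instance Definition _ :=
  GRing.isSubmodClosed.Build R V (submod_pred W_closed) W_closed.

Record submod := Submod { submod_val : V; _ : submod_val \in submod_pred W_closed }.
HB.instance Definition _ := [isSub for submod_val].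
HB.instance Definition _ := [Choice of submod by <:].
HB.instance Definition _ := [SubChoice_isSubLmodule of submod by <:].

(** Stated as a sigma type, because the object part of a functor is later built from its first
    component. *)
Lemma exists_submodule :
  {K : lmodType R & {k : {linear K -> V} | injective k & range k = W}}.
Proof.
exists submod; exists (\val : {linear submod -> V}); first exact: val_inj.
apply/seteqP; split=> [_ [[x Wx] _ <-]|x Wx]; first exact/set_mem.
by exists (Submod (mem_set Wx : x \in submod_pred W_closed)).
Qed.

Definition quotmod := Quotient.quot (submod_pred W_closed).
HB.instance Definition _ := GRing.Zmodule.on quotmod.

Definition quotmod_pi (x : V) : quotmod := \pi_(quotmod) x.

Definition quotmod_scale (a : R) (x : quotmod) := quotmod_pi (a *: repr x).

Lemma quotmod_piB x y : (quotmod_pi x == quotmod_pi y) = (x - y \in [in W]).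
Proof. by rewrite [LHS]eqmodE. Qed.

Lemma quotmod_pi_is_additive : zmod_morphism quotmod_pi.
Proof. exact: pi_is_zmod_morphism. Qed.

HB.instance Definition _ := GRing.isZmodMorphism.Build V quotmod quotmod_pi
  quotmod_pi_is_additive.

(** Scaling is defined through representatives; this is its independence of their choice, which
    holds because [W] is stable under scaling. The module axioms then descend from [V]. *)
Lemma quotmod_piZ a x : quotmod_pi (a *: x) = quotmod_scale a (quotmod_pi x).
Proof.
apply/eqP; rewrite quotmod_piB -scalerBr.
suff: x - repr (quotmod_pi x) \in submod_pred W_closed by exact: rpredZ.
by rewrite -[_ \in _]quotmod_piB /quotmod_pi reprK.
Qed.

Lemma quotmod_ind (P : quotmod -> Prop) :
  (forall x, P (quotmod_pi x)) -> forall x, P x.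
Proof. by move=> Ppi x; rewrite -[x]reprK; exact: Ppi. Qed.

Lemma quotmod_scaleA a b x :
  quotmod_scale a (quotmod_scale b x) = quotmod_scale (a * b) x.
Proof. by elim/quotmod_ind: x => x; rewrite -!quotmod_piZ scalerA. Qed.

Lemma quotmod_scale1 : left_id 1 quotmod_scale.
Proof. by elim/quotmod_ind=> x; rewrite -quotmod_piZ scale1r. Qed.

Lemma quotmod_scaleDr : right_distributive quotmod_scale +%R.
Proof.
move=> a; elim/quotmod_ind=> x; elim/quotmod_ind=> y.
by rewrite -raddfD -!quotmod_piZ -raddfD scalerDr.
Qed.

Lemma quotmod_scaleDl v : {morph quotmod_scale^~ v : a b / a + b}.
Proof.
by elim/quotmod_ind: v => x a b; rewrite -!quotmod_piZ -raddfD scalerDl.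
Qed.

HB.instance Definition _ := GRing.Zmodule_isLmodule.Build R quotmod
  quotmod_scaleA quotmod_scale1 quotmod_scaleDr quotmod_scaleDl.

HB.instance Definition _ := GRing.isScalable.Build R V quotmod *:%R quotmod_pi
  quotmod_piZ.

Lemma exists_quotient_module :
  {Q : lmodType R & {q : {linear V -> Q} | range q = setT & q @^-1` [set 0] = W}}.
Proof.
exists quotmod; exists (quotmod_pi : {linear V -> quotmod}).
  by apply/seteqP; split=> // y _; exists (repr (y : quotmod)); last exact: reprK.
have pi0 x : (quotmod_pi x = 0) <-> W x.
  split=> [/eqP|Wx]; rewrite -[0](raddf0 quotmod_pi).
    by rewrite quotmod_piB subr0 => /set_mem.
  by apply/eqP; rewrite quotmod_piB subr0; exact/mem_set.
by apply/seteqP; split=> x /pi0.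
Qed.

End Submodule.

(** * Factoring linear maps through injections and surjections *)

Section Factorization.
Variables (R : pzRingType).

(** Any choice of preimages under [k] is linear, since [k] is injective and linear. *)
Lemma linear_lift (T K V : lmodType R) (k : {linear K -> V}) (u : {linear T -> V}) :
  injective k -> range u `<=` range k -> {v : {linear T -> K} | k \o v =1 u}.
Proof.
move=> k_inj u_k.
have /cid[v kv] : exists v : T -> K, forall x : T, k (v x) = u x.
  suff /choice[v] : forall x : T, exists y : K, k y = u x by exists v.
  by move=> x; have /u_k[y _ <-] : range u (u x) by [exists x]; exists y.
have v_add (x y : T) : v (x - y) = v x - v y.
  by apply: k_inj; rewrite linearB /= !kv linearB.
have v_scale a (x : T) : v (a *: x) = a *: v x.
  by apply: k_inj; rewrite linearZ /= !kv linearZ.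
pose vA := GRing.isZmodMorphism.Build _ _ v v_add.
pose vS := GRing.isScalable.Build _ _ _ _ v v_scale.
pose vL : {linear T -> K} := HB.pack v vA vS.
by exists vL.
Qed.

(** The section [s] of [q] need not be linear, but [u \o s] is, because [u] is constant on the
    fibres of [q]. *)
Lemma linear_desc (V Q T : lmodType R) (q : {linear V -> Q}) (u : {linear V -> T}) :
  range q = setT -> (forall x, q x = 0 -> u x = 0) ->
  {v : {linear Q -> T} | v \o q =1 u}.
Proof.
move=> q_surj qu0.
have /cid[s qs] : exists s : Q -> V, forall y : Q, q (s y) = y.
  suff /choice[s] : forall y : Q, exists x : V, q x = y by exists s.
  by move=> y; have : range q y by [rewrite q_surj]; case=> x _ <-; exists x.
have quE (x y : V) : q x = q y -> u x = u y.
  move=> qxy; apply/eqP; rewrite -subr_eq0 -linearB; apply/eqP/qu0.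
  by rewrite linearB /= qxy subrr.
pose v y := u (s y).
have v_add (x y : Q) : v (x - y) = v x - v y.
  by rewrite /v -linearB; apply: quE; rewrite linearB /= !qs.
have v_scale a (x : Q) : v (a *: x) = a *: v x.
  by rewrite /v -linearZ; apply: quE; rewrite linearZ /= !qs.
pose vA := GRing.isZmodMorphism.Build _ _ v v_add.
pose vS := GRing.isScalable.Build _ _ _ _ v v_scale.
pose vL : {linear Q -> T} := HB.pack v vA vS.
by exists vL => x /=; apply: quE; rewrite qs.
Qed.

End Factorization.

(** * FI-modules: subobjects, quotients and finite generation *)

Section FIModules.
Variable R : comPzRingType.
Implicit Types (U V W : FImodule R) (S T Q : finType).

Definition fi_app V W (t : nattrans V W) S :
  {linear fi_space V S -> fi_space W S} := t S.

Lemma fi_mapM V S T Q (f : S -> T) (g : T -> Q) (fI : injective f)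
    (gI : injective g) (gfI : injective (g \o f)) x :
  fi_map V gfI x = fi_map V gI (fi_map V fI x).
Proof.
rewrite /fi_map.
have -> : exist _ (g \o f) gfI = (exist _ g gI : @mor FI T Q) \mc
    (exist _ f fI : @mor FI S T) :> @mor FI S Q by exact: eq_exist.
exact: (congr1 (fun h : {linear fi_space V S -> fi_space V Q} => h x)
  (fctmapM V (exist _ g gI : @mor FI T Q) (exist _ f fI : @mor FI S T))).
Qed.

Lemma eq_fi_map V S T (f g : S -> T) (fI : injective f) (gI : injective g) x :
  f =1 g -> fi_map V fI x = fi_map V gI x.
Proof.
move=> /funext fg; subst g; congr (fi_map V _ x); exact: Prop_irrelevance.
Qed.

Lemma fi_map1 V S (fI : injective (@id S)) x : fi_map V fI x = x.
Proof.
rewrite /fi_map (Prop_irrelevance fI (@inj_id S)).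
exact: (congr1 (fun h : {linear fi_space V S -> fi_space V S} => h x)
  (fctmap1 V S)).
Qed.

Lemma fi_app_nat V W (t : nattrans V W) S T (f : S -> T) (fI : injective f) x :
  fi_map W fI (fi_app t S x) = fi_app t T (fi_map V fI x).
Proof.
exact: (congr1 (fun h : {linear fi_space V S -> fi_space W T} => h x)
  (ntnat t (exist _ f fI : @mor FI S T))).
Qed.

Lemma nattrans_of_linear V W (t : forall S, {linear fi_space V S -> fi_space W S}) :
  (forall S T (f : S -> T) (fI : injective f) x,
    fi_map W fI (t S x) = t T (fi_map V fI x)) ->
  {u : nattrans V W | forall S x, fi_app u S x = t S x}.
Proof.
move=> t_nat; unshelve eexists (@NatTrans FI (Mod R) V W t _) => //.
by move=> S T [f fI]; apply: linear_eqP => x; exact: t_nat.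
Qed.

Lemma fi_app_eqP V W (s t : nattrans V W) :
  (forall S x, fi_app s S x = fi_app t S x) -> s = t.
Proof. by move=> st; apply: nattrans_eq => S; apply: linear_eqP; exact: st. Qed.

Lemma subfi_fi_map V (W : subFImodule V) S T (f : S -> T) (fI : injective f) x :
  W S x -> W T (fi_map V fI x).
Proof. by move=> Wx; apply: (@subfi_map _ _ W S T f fI); exists x. Qed.

Lemma subfi_lin V (W : subFImodule V) S a x y :
  W S x -> W S y -> W S (a *: x + y).
Proof.
by move=> /mem_set Wx /mem_set Wy; apply/set_mem; case: (subfi_submod W S) => _; exact.
Qed.

Lemma subfi0 V (W : subFImodule V) S : W S 0.
Proof. by apply/set_mem; case: (subfi_submod W S). Qed.

Lemma subfiD V (W : subFImodule V) S x y : W S x -> W S y -> W S (x + y).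
Proof. by move=> Wx Wy; rewrite -[x]scale1r; exact: subfi_lin. Qed.

(** The transition maps are lifted through the injections [k S]; functoriality can be checked after
    composing with these. *)
Lemma exists_functor_sub V (W : subFImodule V) :
  {K : FImodule R & {k : nattrans K V |
    forall S, injective (fi_app k S) /\ range (fi_app k S) = W S}}.
Proof.
pose K S : lmodType R := projT1 (exists_submodule (subfi_submod W S)).
pose k S : {linear K S -> fi_space V S} :=
  s2val (projT2 (exists_submodule (subfi_submod W S))).
have k_inj S : injective (k S) :=
  s2valP (projT2 (exists_submodule (subfi_submod W S))).
have k_range S : range (k S) = W S :=
  s2valP' (projT2 (exists_submodule (subfi_submod W S))).
have lift S T (f : @mor FI S T) :
    {v : {linear K S -> K T} | k T \o v =1 fi_map V (svalP f) \o k S}.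
  apply: (linear_lift (u := fi_map V (svalP f) \o k S)) => //.
  move=> _ [x _ <-]; rewrite k_range; apply: subfi_fi_map.
  by rewrite -k_range; exists x.
have liftE S T (f : @mor FI S T) x :
  k T (sval (lift S T f) x) = fi_map V (svalP f) (k S x) := svalP (lift S T f) x.
have lift1 (S : FI) : sval (lift _ _ (idmor S)) = idfun :> {linear K S -> K S}.
  by apply: linear_eqP => x; apply: k_inj; rewrite liftE fi_map1.
have liftM (S T Q : FI) (g : mor T Q) (f : mor S T) :
    sval (lift _ _ (g \mc f)) =
    (sval (lift _ _ g) \o sval (lift _ _ f)) :> {linear K S -> K Q}.
  apply: linear_eqP => x; apply: k_inj.
  by rewrite liftE [RHS]liftE liftE; exact: fi_mapM.
pose KF : FImodule R :=
  @Functor FI (Mod R) K (fun S T f => sval (lift S T f)) lift1 liftM.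
have [|t tE] := @nattrans_of_linear KF V k.
  by move=> S T f fI x; rewrite [RHS]liftE; exact: eq_fi_map.
exists KF, t => S; have -> : fi_app t S = k S by apply: linear_eqP; exact: tE.
by split.
Qed.

(** Dual construction: the transition maps descend along the surjections [q S], and identities are
    checked on elements [q S x]. *)
Lemma exists_functor_quotient V (W : subFImodule V) :
  {Q : FImodule R & {q : nattrans V Q | forall S,
    range (fi_app q S) = setT /\ fi_app q S @^-1` [set 0] = W S}}.
Proof.
pose Q S : lmodType R := projT1 (exists_quotient_module (subfi_submod W S)).
pose q S : {linear fi_space V S -> Q S} :=
  s2val (projT2 (exists_quotient_module (subfi_submod W S))).
have q_range S : range (q S) = setT :=
  s2valP (projT2 (exists_quotient_module (subfi_submod W S))).
have q_ker S : q S @^-1` [set 0] = W S :=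
  s2valP' (projT2 (exists_quotient_module (subfi_submod W S))).
have desc S T (f : @mor FI S T) :
    {v : {linear Q S -> Q T} | v \o q S =1 q T \o fi_map V (svalP f)}.
  apply: (linear_desc (u := q T \o fi_map V (svalP f))) => // x qx0.
  suff : (q T @^-1` [set 0]) (fi_map V (svalP f) x) by [].
  by rewrite q_ker; apply: subfi_fi_map; rewrite -q_ker.
have descE S T (f : @mor FI S T) x :
  sval (desc S T f) (q S x) = q T (fi_map V (svalP f) x) := svalP (desc S T f) x.
have q_ind S (P : Q S -> Prop) : (forall x, P (q S x)) -> forall y, P y.
  by move=> Pq y; have : range (q S) y by [rewrite q_range]; case=> x _ <-.
have desc1 (S : FI) : sval (desc _ _ (idmor S)) = idfun :> {linear Q S -> Q S}.
  by apply: linear_eqP; apply: q_ind => x; rewrite descE fi_map1.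
have descM (S T U : FI) (g : mor T U) (f : mor S T) :
    sval (desc _ _ (g \mc f)) =
    (sval (desc _ _ g) \o sval (desc _ _ f)) :> {linear Q S -> Q U}.
  apply: linear_eqP; apply: q_ind => x /=; rewrite !descE.
  by congr (q _ _); exact: fi_mapM.
pose QF : FImodule R :=
  @Functor FI (Mod R) Q (fun S T f => sval (desc S T f)) desc1 descM.
have [|t tE] := @nattrans_of_linear V QF q.
  by move=> S T f fI x; rewrite [LHS]descE; congr (q _ _); exact: eq_fi_map.
exists QF, t => S; have -> : fi_app t S = q S by apply: linear_eqP; exact: tE.
by split.
Qed.

Definition make_subFImodule V (W : forall S, set (fi_space V S))
  (W0 : forall S, W S 0)
  (Wlin : forall S a x y, W S x -> W S y -> W S (a *: x + y))
  (Wmap : forall S T (f : S -> T) (fI : injective f) x,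
    W S x -> W T (fi_map V fI x)) : subFImodule V.
Proof.
refine (@SubFImodule R V W _ _).
- split=> [|a x y /set_mem Wx /set_mem Wy]; apply/mem_set; first exact: W0.
  exact: Wlin.
- by move=> S T f fI _ [x Wx <-]; exact: Wmap.
Defined.

Definition preim_subFImodule V W (t : nattrans V W) (U : subFImodule W) :
  subFImodule V.
Proof.
refine (@make_subFImodule V (fun S => fi_app t S @^-1` U S) _ _ _).
- by move=> S; rewrite /preimage /= linear0; exact: subfi0.
- by move=> S a x y; rewrite /preimage /= linearP; exact: subfi_lin.
- by move=> S T f fI x; rewrite /preimage /= -fi_app_nat; exact: subfi_fi_map.
Defined.

Definition image_subFImodule V W (t : nattrans V W) (U : subFImodule V) :
  subFImodule W.
Proof.
refine (@make_subFImodule W (fun S => fi_app t S @` U S) _ _ _).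
- by move=> S; exists 0; [exact: subfi0|rewrite linear0].
- move=> S a _ _ [x Ux <-] [y Uy <-]; exists (a *: x + y); last by rewrite linearP.
  exact: subfi_lin.
- move=> S T f fI _ [x Ux <-]; exists (fi_map V fI x); last by rewrite fi_app_nat.
  exact: subfi_fi_map.
Defined.

Definition zero_subFImodule V : subFImodule V.
Proof.
refine (@make_subFImodule V (fun S => [set 0]) _ _ _) => //.
- by move=> S a x y /= -> ->; rewrite scaler0 addr0.
- by move=> S T f fI x /= ->; rewrite linear0.
Defined.

Definition full_subFImodule V : subFImodule V :=
  @make_subFImodule V (fun S => setT) (fun _ => I) (fun _ _ _ _ _ _ => I)
    (fun _ _ _ _ _ _ => I).

Definition contains V (U : subFImodule V) (X : set {n : nat & fi_space V 'I_n}) :=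
  forall n (x : fi_space V 'I_n), X (existT _ n x) -> U 'I_n x.

Lemma finitely_generatedP V : finitely_generated_FImodule V <->
  exists2 X, finite_set X & forall U : subFImodule V,
    contains U X -> forall S x, U S x.
Proof.
split=> -[X finX XV]; exists X => //.
  move=> U UX S x; apply: contrapT => NUx; apply: XV; exists U; last by case=> n y /UX.
  by exists S => US; apply: NUx; rewrite US.
case=> U [S NUS] UX; apply: NUS; apply/seteqP; split=> // x _.
by apply: XV => n y /UX.
Qed.

(** The images of the generators generate: the preimage of a sub-FI-module containing them contains
    all generators of [V], hence is everything. *)
Lemma finitely_generated_onto V W (t : nattrans V W) :
  (forall S, range (fi_app t S) = setT) ->
  finitely_generated_FImodule V -> finitely_generated_FImodule W.
Proof.
move=> t_onto /finitely_generatedP[X finX XV]; apply/finitely_generatedP.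
exists ((fun z => existT _ (projT1 z) (fi_app t _ (projT2 z))) @` X).
  exact: finite_image.
move=> U UX S y.
have [x _ <-] : range (fi_app t S) y by rewrite t_onto.
apply: (XV (preim_subFImodule t U)) => n z Xz /=.
by apply: UX; exists (existT _ n z).
Qed.
End FIModules.

(** * Combinatorics of monomials *)

(** Each index is chosen to minimise [u] on the tail after the previous index; all later choices lie
    in that tail. *)
Lemma nondecreasing_subsequence (u : nat -> nat) : exists s : nat -> nat,
  {homo s : i j / (i < j)%N} /\ {homo u \o s : i j / (i <= j)%N}.
Proof.
have tail_min N : exists j, (N <= j)%N /\ forall l, (N <= l)%N -> (u j <= u l)%N.
  pose P v := `[< exists2 j, (N <= j)%N & u j = v >].
  have exP : exists v, P v by exists (u N); apply/asboolP; exists N.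
  case: (ex_minnP exP) => v /asboolP[j Nj <-] v_min; exists j; split=> // l Nl.
  by apply: v_min; apply/asboolP; exists l.
have [c cP] := choice tail_min.
pose s := fix s t := if t is t'.+1 then c (s t').+1 else c 0%N.
have s_lt t : (s t < s t.+1)%N by case: (cP (s t).+1).
have s_homo : {homo s : i j / (i < j)%N} := homo_ltn ltn_trans s_lt.
exists s; split=> //; apply: homo_leq leqnn leq_trans _ => t /=.
have min0 N l : (N <= l)%N -> (u (c N) <= u l)%N by case: (cP N) => _; exact.
case: t => [|t]; apply: min0 => //.
by apply: ltn_trans (s_lt t) (s_lt t.+1).
Qed.

(** The coordinates in [K] are treated one at a time; those already monotone remain so along a
    further subsequence. *)
Lemma dickson (I : eqType) (u : I -> nat -> nat) (K : seq I) :
  exists s : nat -> nat, {homo s : i j / (i < j)%N} /\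
    {in K, forall k, {homo u k \o s : i j / (i <= j)%N}}.
Proof.
elim: K => [|k K [s [s_lt uK]]]; first by exists id; split.
have [t [t_lt ut]] := nondecreasing_subsequence (u k \o s).
exists (s \o t); split=> [i j ij|k'].
  by apply: s_lt; exact: t_lt.
rewrite inE => /predU1P[->|k'K] i j ij; first exact: ut.
apply: (uK k' k'K).
exact: (homo_leq leqnn leq_trans (fun n => ltnW (t_lt _ _ (ltnSn n)))).
Qed.

(** The ideal generated by all [c j] has finitely many generators, which together involve only
    finitely many of the [c j]. *)
Lemma noetherian_sequence (R : comPzRingType) (c : nat -> R) : noetherian R ->
  exists J (r : nat -> R), c J = \sum_(j < J) r j * c j.
Proof.
move=> HR.
pose comb N (r : nat -> R) : R := \sum_(j < N) r j * c j.
have widen N M r : (N <= M)%N -> exists r', comb N r = comb M r'.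
  move=> NM; exists (fun j => if (j < N)%N then r j else 0).
  rewrite /comb (big_ord_widen_cond _ predT (fun j => r j * c j) NM).
  rewrite big_mkcond; apply: eq_bigr => j _ /=.
  by case: ifP; rewrite ?mul0r.
pose I : set R^o := [set x | exists N r, x = comb N r].
have I_closed : submod_closed [in I].
  split=> [|a x y /set_mem[N [r ->]] /set_mem[M [q ->]]]; apply/mem_set.
    by exists 0%N, (fun=> 0); rewrite /comb big_ord0.
  have [r' ->] := widen _ _ r (leq_maxl N M); have [q' ->] := widen _ _ q (leq_maxr N M).
  exists (maxn N M), (fun j => a * r' j + q' j).
  rewrite /comb scaler_sumr -big_split; apply: eq_bigr => j _.
  by rewrite /= mulrDl -mulrA.
have [n [a IE]] := HR I I_closed.
have Ia i : exists r : nat * (nat -> R), a i = comb r.1 r.2.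
  suff [N [r ->]] : I (a i) by exists (N, r).
  rewrite IE; exists (fun j => (j == i)%:R).
  rewrite (bigD1 i) //= eqxx mul1r big1 ?addr0 // => j /negPf ->.
  by rewrite mul0r.
have {Ia} [Nr aE] := choice Ia.
(* [J] bounds the number of terms used by every [a i], so the whole ideal, including [c J], is
   spanned by the [c j] with [j < J]. *)
pose J := (\max_i (Nr i).1)%N.
have /choice[r aJ] i : exists r, a i = comb J r.
  by rewrite aE; apply: widen; exact: (leq_bigmax i).
have : I (c J).
  exists J.+1, (fun j => (j == J)%:R); rewrite /comb big_ord_recr /= eqxx mul1r.
  rewrite big1 ?add0r // => j _; by rewrite ltn_eqF ?mul0r.
rewrite IE => -[b cJ]; exists J, (fun j => \sum_i b i * r i j); rewrite [LHS]cJ.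
under eq_bigr => i _ do rewrite aJ mulr_sumr.
rewrite exchange_big; apply: eq_bigr => j _.
by rewrite mulr_suml; apply: eq_bigr => i _; rewrite mulrA.
Qed.

(* [h] shifts each point [p] by the largest of the shifts [g k - f k] of the
   marked points [f k <= p]; the gap condition makes these shifts nondecreasing
   in [f k]. *)
Lemma extend_increasing d n m (f : 'I_d -> 'I_n) (g : 'I_d -> 'I_m) :
  injective f -> (n <= m)%N ->
  (forall k, f k <= g k)%N -> (forall k, n - f k <= m - g k)%N ->
  (forall k l, f l - f k <= g l - g k)%N ->
  exists h : 'I_n -> 'I_m, {homo h : p q / (p < q)%N} /\ forall k, h (f k) = g k.
Proof.
move=> f_inj nm fg bnd gap.
pose shift (p : nat) := \max_(k < d | (f k <= p)%N) (g k - f k).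
(* By [bnd] no shift exceeds [m - n], so [h] stays inside ['I_m]. *)
have shift_bound p : (shift p <= m - n)%N.
  apply/bigmax_leqP => k _; have := bnd k.
  by have := ltn_ord (f k); have := ltn_ord (g k); lia.
have shift_homo p q : (p <= q)%N -> (shift p <= shift q)%N.
  move=> pq; apply/bigmax_leqP => k fkp.
  by apply: leq_bigmax_cond; exact: leq_trans pq.
have hP (p : 'I_n) : (p + shift p < m)%N.
  by have := shift_bound p; have := ltn_ord p; lia.
exists (fun p => Ordinal (hP p)); split=> [p q pq|k] /=.
  by have := shift_homo p q (ltnW pq); lia.
apply: val_inj => /=; suff -> : shift (f k) = (g k - f k)%N by rewrite subnKC.
apply/eqP; rewrite eqn_leq; apply/andP; split; last first.
  exact: (leq_bigmax_cond (F := fun l => g l - f l)%N).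
apply/bigmax_leqP => l flk.
have [/val_inj/f_inj -> //|fl_lt] := eqVneq (f l : nat) (f k).
have := gap l k; have := fg l; have := fg k; lia.
Qed.

(** The comparison is decided at the first difference, and both equality and strict order of letters
    pass from [f] to [g]. *)
Lemma ltxi_map_homo (T : Type) disp (A B : orderType disp) (f : T -> A)
    (g : T -> B) (s t : seq T) :
  (forall p q, (f p < f q)%O -> (g p < g q)%O) ->
  (forall p q, f p = f q -> g p = g q) ->
  (map f s < map f t :> seqlexi A)%O -> (map g s < map g t :> seqlexi B)%O.
Proof.
move=> fg_lt fg_eq; elim: s t => [|p s IHs] [|q t] //=.
rewrite !ltxi_cons => /andP[]. rewrite le_eqVlt => /predU1P[pq|pq].
  by rewrite pq (fg_eq _ _ pq) !lexx /=; exact: IHs.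
by move=> _; rewrite (ltW (fg_lt _ _ pq)) leNgt fg_lt.
Qed.

(** * Monomials, their lexicographic order and their divisibility *)

Section Monomials.
Variables (I : finType) (d : I -> nat).
Implicit Types (S T : finType).

(* A pair [(i, f)] stands for the element [f_* (v i)] of an FI-module with
   generators [v i] in degrees [d i]. *)
Definition monomial S :=
  {i : I & {f : {ffun 'I_(d i) -> S} | injectiveb f}}.

Definition mon_fun S (x : monomial S) : 'I_(d (tag x)) -> S := val (tagged x).
Arguments mon_fun {S} x _.

Lemma mon_inj S (x : monomial S) : injective (mon_fun x).
Proof. exact/injectiveP/(valP (tagged x)). Qed.

Definition make_mon S i (f : 'I_(d i) -> S) (fI : injective f) : monomial S.
Proof.
exists i; exists (finfun f); apply/injectiveP => k l; rewrite !ffunE; exact: fI.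
Defined.

Lemma make_monE S i (f : 'I_(d i) -> S) (fI : injective f) k :
  mon_fun (make_mon fI) k = f k.
Proof. exact: ffunE. Qed.

Lemma eq_monomial S i (f g : {f : {ffun 'I_(d i) -> S} | injectiveb f}) :
  mon_fun (existT _ i f) =1 mon_fun (existT _ i g) ->
  existT _ i f = existT _ i g :> monomial S.
Proof. by move=> fg; congr existT; apply/val_inj/ffunP. Qed.

Definition mon_act S T (h : S -> T) (hI : injective h) (x : monomial S) :
  monomial T := make_mon (inj_comp hI (@mon_inj S x)).

Lemma mon_act_inj S T (h : S -> T) (hI : injective h) : injective (mon_act hI).
Proof.
move=> [i f] [j g] e; have /= ij := congr1 (@tag _ _) e; subst j.
apply: eq_monomial => k; apply: (hI).
have /(congr1 val) /= /ffunP/(_ k) := eq_from_Tagged e.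
by rewrite !ffunE.
Qed.

Definition mon_word n (x : monomial 'I_n) : seq nat :=
  [seq nat_of_ord (mon_fun x k) | k <- enum 'I_(d (tag x))].

(** Indexing by [nat] with default 0 makes positions of monomials on different generators comparable
    without casts. *)
Definition mon_pos n (x : monomial 'I_n) (k : nat) : nat := nth 0 (mon_word x) k.

Lemma mon_posE n (x : monomial 'I_n) (k : 'I_(d (tag x))) :
  mon_pos x k = mon_fun x k :> nat.
Proof.
rewrite /mon_pos (nth_map k); first by rewrite nth_ord_enum.
by rewrite size_enum_ord.
Qed.

(** Rephrases [extend_increasing] as inequalities between natural numbers, the form to which
    [dickson] applies. *)
Lemma mon_divides n m (x : monomial 'I_n) (y : monomial 'I_m) :
  tag x = tag y -> (n <= m)%N ->
  (forall k, (k < d (tag x))%N -> (mon_pos x k <= mon_pos y k)%N) ->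
  (forall k, (k < d (tag x))%N -> (n - mon_pos x k <= m - mon_pos y k)%N) ->
  (forall k l, (k < d (tag x))%N -> (l < d (tag x))%N ->
    (mon_pos x l - mon_pos x k <= mon_pos y l - mon_pos y k)%N) ->
  exists (h : 'I_n -> 'I_m) (hI : injective h),
    {homo h : p q / (p < q)%N} /\ mon_act hI x = y.
Proof.
case: x y => [i f] [j g] /= ij; subst j => nm pos_le bnd gap.
have [|||h [h_homo hf]] := extend_increasing (@mon_inj _ (existT _ i f)) nm
    (g := mon_fun (existT _ i g)).
- by move=> k; rewrite -!mon_posE pos_le /=.
- by move=> k; rewrite -!mon_posE bnd /=.
- by move=> k l; rewrite -!mon_posE gap /=.
have hI : injective h.
  by move=> p q; case: (ltngtP p q) => [/h_homo|/h_homo|/val_inj//] + e;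
    rewrite e ltnn.
exists h, hI; split=> //; apply: eq_monomial => k; rewrite -hf; exact: ffunE.
Qed.

(** With the generator compared first, ties leave only words of equal length to compare. *)
Definition mon_key n (x : monomial 'I_n) : seqlexi nat :=
  (enum_rank (tag x) : nat) :: mon_word x.

Lemma mon_key_inj n : injective (@mon_key n).
Proof.
move=> [i f] [j g] [] /= /val_inj/enum_rank_inj ij; subst j => fg.
apply: eq_monomial => k; apply: val_inj.
by rewrite /= -!mon_posE /mon_pos fg.
Qed.

Definition mon_lt n (x y : monomial 'I_n) := (mon_key x < mon_key y)%O.

(** Acting by [h] keeps the generator and changes each letter by a strictly increasing map, so the
    first difference keeps its place and direction. *)
Lemma mon_act_homo n m (h : 'I_n -> 'I_m) (hI : injective h) :
  {homo h : p q / (p < q)%N} ->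
  {homo mon_act hI : x y / mon_lt x y}.
Proof.
move=> h_homo x y; rewrite /mon_lt /mon_key !ltxi_cons => /andP[-> /=].
case: (_ <= _)%O => //=.
have word z : mon_word (mon_act hI z) =
    [seq nat_of_ord (h p) | p <- [seq mon_fun z k | k <- enum 'I_(d (tag z))]].
  by rewrite -map_comp; apply: eq_map => k; congr nat_of_ord; exact: make_monE.
have word0 (z : monomial 'I_n) : mon_word z =
  [seq nat_of_ord p | p <- [seq mon_fun z k | k <- enum 'I_(d (tag z))]] := map_comp _ _ _.
rewrite !word !word0.
apply: ltxi_map_homo => [p q|p q /val_inj -> //]; exact: h_homo.
Qed.

(** A numerical measure of the order, through which a least leading monomial is found by minimising
    over [nat]. *)
Definition mon_rank n (x : monomial 'I_n) := #|[pred y | mon_lt y x]|.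

Lemma mon_rank_homo n (x y : monomial 'I_n) :
  mon_lt x y -> (mon_rank x < mon_rank y)%N.
Proof.
move=> xy; apply/proper_card/properP; split.
  by apply/fintype.subsetP => z; rewrite !inE => zx; exact: lt_trans xy.
by exists x; rewrite !inE // /mon_lt ltxx.
Qed.

Lemma mon_lt_total n (x y : monomial 'I_n) : x != y -> mon_lt x y || mon_lt y x.
Proof. by move=> xy; rewrite /mon_lt -neq_lt (inj_eq (@mon_key_inj n)). Qed.

(** The hypotheses of [mon_divides] say that finitely many numbers attached to [x j] grow with [j],
    so Dickson's lemma applies to them. *)
Lemma dickson_monomial (n : nat -> nat) (x : forall j, monomial 'I_(n j)) :
  exists s : nat -> nat, {homo s : i j / (i < j)%N} /\
    forall i j, (i <= j)%N ->
      exists (h : 'I_(n (s i)) -> 'I_(n (s j))) (hI : injective h),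
      {homo h : p q / (p < q)%N} /\ mon_act hI (x (s i)) = x (s j).
Proof.
(* [D] bounds all degrees, so one finite index type [idx] serves every [j], whatever its
   generator. *)
pose D := (\max_i d i)%N.
pose idx := (option bool + ('I_D + 'I_D) + 'I_D * 'I_D)%type.
pose rk j : nat := enum_rank (tag (x j)).
(* A number and its complement to [#|I|] are both nondecreasing along a sequence
   only if the number is constant, so the generator will not vary. *)
pose u (a : idx) j : nat := match a with
  | inl (inl None) => n j
  | inl (inl (Some true)) => rk j
  | inl (inl (Some false)) => (#|I| - rk j)%N
  | inl (inr (inl k)) => mon_pos (x j) k
  | inl (inr (inr k)) => (n j - mon_pos (x j) k)%N
  | inr (k, l) => (mon_pos (x j) l - mon_pos (x j) k)%N
  end.
have [s [s_lt us]] := dickson u (enum (idx : finType)).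
exists s; split=> // i j ij.
have {}us a : (u a (s i) <= u a (s j))%N by apply: us; rewrite ?mem_enum.
have dD k : (k < d (tag (x (s i))))%N -> (k < D)%N.
  by move/leq_trans; apply; exact: leq_bigmax.
apply: mon_divides.
- apply: enum_rank_inj; apply: val_inj => /=.
  have := us (inl (inl (Some true))); have := us (inl (inl (Some false))).
  rewrite /u -/(rk (s i)) -/(rk (s j)).
  have : (rk (s i) < #|I|)%N := ltn_ord _; have : (rk (s j) < #|I|)%N := ltn_ord _.
  by move: (rk _) (rk _) #|I| => a b c; lia.
- exact: us (inl (inl None)).
- by move=> k /dD kD; exact: us (inl (inr (inl (Ordinal kD)))).
- by move=> k /dD kD; exact: us (inl (inr (inr (Ordinal kD)))).
- by move=> k l /dD kD /dD lD; exact: us (inr (Ordinal kD, Ordinal lD)).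
Qed.

End Monomials.

(** * Sub-FI-modules of finitely generated FI-modules *)

Section Noetherianity.
Variables (R : comPzRingType) (V : FImodule R).

Lemma subfi_sum (U : subFImodule V) (S : finType) m (a : 'I_m -> R)
    (x : 'I_m -> fi_space V S) :
  (forall j, U S (x j)) -> U S (\sum_j a j *: x j).
Proof.
move=> Ux; apply: (big_ind (U S)) => [|y z|j _]; [exact: subfi0|exact: subfiD|].
by rewrite -[X in U S X]addr0; apply: subfi_lin; last exact: subfi0.
Qed.

(** * Linear combinations of monomials and their values in [V] *)

Section Evaluation.
Variables (I : finType) (d : I -> nat) (v : forall i, fi_space V 'I_(d i)).
Implicit Types (S T : finType).

Definition mon_eval S (x : monomial d S) : fi_space V S :=
  fi_map V (@mon_inj _ _ _ x) (v (tag x)).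

Lemma mon_eval_act S T (h : S -> T) (hI : injective h) (x : monomial d S) :
  mon_eval (mon_act hI x) = fi_map V hI (mon_eval x).
Proof.
rewrite /mon_eval -(fi_mapM _ _ (inj_comp hI (@mon_inj _ _ _ x))).
apply: eq_fi_map; exact: make_monE.
Qed.

Definition eval S (c : monomial d S -> R) : fi_space V S :=
  \sum_x c x *: mon_eval x.

Lemma eval_lin S a (c b : monomial d S -> R) :
  eval (fun x => a * c x + b x) = a *: eval c + eval b.
Proof.
rewrite /eval scaler_sumr -big_split; apply: eq_bigr => x _ /=.
by rewrite scalerDl scalerA.
Qed.

Lemma eval0 S (c : monomial d S -> R) : (forall x, c x = 0) -> eval c = 0.
Proof. by move=> c0; rewrite /eval big1 // => x _; rewrite c0 scale0r. Qed.

Definition push S T (h : S -> T) (hI : injective h) (c : monomial d S -> R)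
    (y : monomial d T) : R :=
  \sum_(x | mon_act hI x == y) c x.

Lemma eval_push S T (h : S -> T) (hI : injective h) c :
  eval (push hI c) = fi_map V hI (eval c).
Proof.
rewrite /eval linear_sum /= (partition_big (mon_act hI) predT) //=.
apply: eq_bigr => y _; rewrite /push scaler_suml; apply: eq_bigr => x /eqP <-.
by rewrite linearZ /= mon_eval_act.
Qed.

(** The values of [eval] form a sub-FI-module, stable under injections by [eval_push], and it
    contains every [v i]. *)
Lemma eval_onto :
  (forall U : subFImodule V, (forall i, U 'I_(d i) (v i)) -> forall S x, U S x) ->
  forall S (x : fi_space V S), exists c, x = eval c.
Proof.
move=> v_gen; pose W S : set (fi_space V S) := [set x | exists c, x = eval c].
have W0 S : W S 0 by exists (fun=> 0); rewrite eval0.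
have Wlin S a x y : W S x -> W S y -> W S (a *: x + y).
  move=> [c ->] [b ->]; exists (fun z => a * c z + b z).
  by rewrite eval_lin.
have Wmap S T (f : S -> T) (fI : injective f) x : W S x -> W T (fi_map V fI x).
  by move=> [c ->]; exists (push fI c); rewrite eval_push.
apply: (v_gen (make_subFImodule W0 Wlin Wmap)).
(* The generator [v i] is the value of the identity monomial with coefficient 1. *)
move=> i /=; pose x : monomial d 'I_(d i) := @make_mon I d 'I_(d i) i id (@inj_id _).
exists (fun y => (y == x)%:R).
rewrite /eval (bigD1 x) //= eqxx scale1r big1 ?addr0 => [|y /negPf ->].
  by rewrite -[LHS](fi_map1 (@inj_id _)); apply: eq_fi_map => k; rewrite make_monE.
by rewrite scale0r.
Qed.

End Evaluation.

Lemma finitely_generated_family : finitely_generated_FImodule V ->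
  exists (I : finType) (d : I -> nat) (v : forall i, fi_space V 'I_(d i)),
    forall U : subFImodule V, (forall i, U 'I_(d i) (v i)) -> forall S x, U S x.
Proof.
move=> /finitely_generatedP[X /finite_seqP[L ->] LV].
exists 'I_(size L), (fun i => projT1 (tnth (in_tuple L) i)),
  (fun i => projT2 (tnth (in_tuple L) i)) => U UL; apply: LV => n x /= xL.
have /tnthP[i xE] : existT _ n x \in in_tuple L by [].
by have := UL i; rewrite -xE.
Qed.

(** Every [S] is in bijection with ['I_#|S|]; an element is carried there and back. *)
Lemma subFImodule_ord (W U : subFImodule V) :
  (forall n x, W 'I_n x -> U 'I_n x) -> forall S x, W S x -> U S x.
Proof.
move=> WU S x Wx.
have -> : x = fi_map V enum_val_inj (fi_map V enum_rank_inj x).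
  rewrite -(fi_mapM _ _ (inj_comp enum_val_inj enum_rank_inj)) -[LHS](fi_map1 (@inj_id _)).
  by apply: eq_fi_map => k; rewrite /= enum_rankK.
by apply/subfi_fi_map/WU/subfi_fi_map.
Qed.

Hypothesis HR : noetherian R.
Hypothesis V_fg : finitely_generated_FImodule V.
Implicit Types (X : set {n : nat & fi_space V 'I_n}).

Theorem subFImodule_finitely_generated (W : subFImodule V) :
  exists X, [/\ finite_set X, contains W X &
    forall U : subFImodule V, contains U X -> forall S x, W S x -> U S x].
Proof.
have [I [d [v v_gen]]] := finitely_generated_family V_fg.
apply: contrapT => W_nfg.
pose ev n := @eval I d v 'I_n.
(* Otherwise [X] would generate [W]; a missed element can be sought over some ['I_n] and written as
   a combination of monomials. *)
have escape X : finite_set X -> contains W X ->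
    exists n (c : monomial d 'I_n -> R), W 'I_n (ev n c) /\
      ~ forall U : subFImodule V, contains U X -> U 'I_n (ev n c).
  move=> finX WX; apply: contrapT => noc; apply: W_nfg; exists X; split=> // U UX.
  apply: subFImodule_ord => n x Wx; have [c xE] := eval_onto v_gen x.
  apply: contrapT => NUx; apply: noc; exists n, c; rewrite /ev -xE; split=> //.
  by move=> /(_ U UX).
(* [c] represents an element of [W] not generated by [X], with leading monomial
   [x] (up to a possibly zero coefficient) as small as possible. *)
pose step X n (c : monomial d 'I_n -> R) (x : monomial d 'I_n) :=
  [/\ W 'I_n (ev n c), ~ (forall U : subFImodule V, contains U X -> U 'I_n (ev n c)),
      forall y, c y != 0 -> y != x -> mon_lt y x &
      forall b, (forall y, b y != 0 -> mon_lt y x) -> W 'I_n (ev n b) ->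
        forall U : subFImodule V, contains U X -> U 'I_n (ev n b)].
have stepP X : finite_set X -> contains W X -> exists n c x, @step X n c x.
  move=> finX WX; have [n [c0 [Wc0 Nc0]]] := escape X finX WX.
  pose lead_below (c : monomial d 'I_n -> R) r :=
    forall x, c x != 0 -> (mon_rank x < r)%N.
  (* [r] strictly bounds the ranks in the support of [c], so the least [r] corresponds to a least
     leading monomial. *)
  pose P r := `[< exists c, [/\ W 'I_n (ev n c),
    ~ (forall U : subFImodule V, contains U X -> U 'I_n (ev n c)) & lead_below c r] >].
  have exP : exists r, P r.
    exists #|{: monomial d 'I_n}|.+1; apply/asboolP; exists c0; split=> // x _.
    by rewrite ltnS max_card.
  (* A bound of 0 forces [c] to vanish, and 0 is never missed; so the minimum is a successor [r.+1],
     and the leading monomial has rank [r]. *)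
  case: (ex_minnP exP) => -[|r] /asboolP[c [Wc Nc c_below]] r_min.
    case: Nc => U _; rewrite /ev eval0; first exact: subfi0.
    by move=> x; apply: contrapT => /eqP/c_below.
  have not_below b : W 'I_n (ev n b) -> lead_below b r ->
      forall U : subFImodule V, contains U X -> U 'I_n (ev n b).
    move=> Wb b_below; apply: contrapT => Nb.
    suff /r_min : P r by rewrite ltnn.
    by apply/asboolP; exists b.
  have [x cx rx] : exists2 x, c x != 0 & mon_rank x = r.
    apply: contrapT => Nx; apply: Nc; apply: not_below => // x cx.
    have := c_below x cx; rewrite ltnS leq_eqVlt => /predU1P[rx|//].
    by case: Nx; exists x.
  exists n, c, x; split=> // [y cy yx|b b_lt Wb].
    have /orP[//|/mon_rank_homo] := mon_lt_total yx.
    by rewrite rx; have := c_below y cy; lia.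
  by apply: not_below => // y /b_lt/mon_rank_homo; rewrite rx.
pose data := {n : nat & ((monomial d 'I_n -> R) * monomial d 'I_n)%type}.
have [next nextP] : {next : set {n : nat & fi_space V 'I_n} -> data | forall X,
    finite_set X -> contains W X ->
    step X (projT1 (next X)) (projT2 (next X)).1 (projT2 (next X)).2}.
  apply: cid; suff /choice[f fP] : forall X, exists z : data, finite_set X -> contains W X ->
    step X (projT1 z) (projT2 z).1 (projT2 z).2 by exists f.
  move=> X; have [[finX WX]|NX] := pselect (finite_set X /\ contains W X).
    by have [n [c [x cxP]]] := stepP X finX WX; exists (existT _ n (c, x)).
  (* For unsuitable [X] any value will do; the one for the empty set serves as default. *)
  have [n [c [x _]]] :=
    stepP set0 (finite_set0 _) (fun _ _ (F : False) => match F with end).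
  by exists (existT _ n (c, x)) => finX WX; case: NX.
pose vec (z : data) : {n : nat & fi_space V 'I_n} :=
  existT _ (projT1 z) (ev _ (projT2 z).1).
(* [hist k] collects the first [k] chosen elements, each missed by the sub-FI-module generated by
   its predecessors. *)
pose hist := fix hist k :=
  if k is k'.+1 then hist k' `|` [set vec (next (hist k'))] else set0.
have histP k : finite_set (hist k) /\ contains W (hist k).
  elim: k => [|k [fink Wk]] /=; first by split.
  split; first by rewrite finite_setU; split.
  move=> n x [/Wk //|xE]; have [Wz _ _ _] := nextP _ fink Wk.
  have : W 'I_(projT1 (vec (next (hist k)))) (projT2 (vec (next (hist k)))) by [].
  by rewrite -xE.
pose z k := next (hist k).
pose n k := projT1 (z k).
pose c k : monomial d 'I_(n k) -> R := (projT2 (z k)).1.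
pose x k : monomial d 'I_(n k) := (projT2 (z k)).2.
have zP k : step (hist k) (n k) (c k) (x k).
  by have [fink Wk] := histP k; exact: nextP.
have hist_vec i j : (i < j)%N -> hist j (vec (z i)).
  elim: j => // j IHj; rewrite ltnS leq_eqVlt => /predU1P[->|/IHj]; [by right|by left].
have [s [s_lt s_div]] := dickson_monomial x.
(* Applied to the leading coefficients along the subsequence. *)
have [J [r cJ]] := noetherian_sequence (fun j => c (s j) (x (s j))) HR.
(* [p j] is the [j]-th chosen combination pushed into degree [n (s J)], where its leading monomial
   becomes [x (s J)] with the same coefficient. *)
have /choice[p pP] (j : 'I_J) : exists p : monomial d 'I_(n (s J)) -> R,
    [/\ p (x (s J)) = c (s j) (x (s j)),
        forall y, y != x (s J) -> p y != 0 -> mon_lt y (x (s J)),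
        W _ (ev _ p) &
        forall U : subFImodule V, contains U (hist (s J)) -> U _ (ev _ p)].
  have [h [hI [h_homo hx]]] := s_div j J (ltnW (ltn_ord j)).
  have [Wc _ c_lt _] := zP (s j).
  exists (push hI (c (s j))); split.
  - rewrite /push (big_pred1 (x (s j))) // => y /=.
    by rewrite -hx (inj_eq (@mon_act_inj _ _ _ _ _ hI)).
  - move=> y yx py.
    have [y' /eqP y'E cy'] : exists2 y', mon_act hI y' == y & c (s j) y' != 0.
      apply: contrapT => Ny; case/eqP: py; rewrite /push big1 // => y' y'y.
      by apply: contrapT => /eqP cy'; apply: Ny; exists y'.
    rewrite -y'E -hx; apply: mon_act_homo => //; apply: c_lt => //.
    by apply: contraNneq yx => y'x; rewrite -y'E y'x hx.
  - by rewrite /ev eval_push; exact: subfi_fi_map.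
  - move=> U UX; rewrite /ev eval_push; apply: subfi_fi_map; apply: UX.
    by apply: hist_vec; apply: s_lt.
(* [q] is generated by earlier choices and agrees with [c (s J)] at [x (s J)]. The difference [b]
   thus has only smaller monomials, so by minimality it is generated too, and with it [c (s J)]. *)
pose q y := \sum_(j < J) r j * p j y.
have ev_q : ev _ q = \sum_(j < J) r j *: ev _ (p j).
  rewrite /ev /eval; under [RHS]eq_bigr => j _ do rewrite scaler_sumr.
  rewrite exchange_big; apply: eq_bigr => y _ /=.
  by rewrite scaler_suml; apply: eq_bigr => j _; rewrite scalerA.
have [Wc Nc c_lt small] := zP (s J); apply: Nc => U UX.
pose b y := -1 * q y + c (s J) y.
have -> : ev _ (c (s J)) = 1 *: ev _ q + ev _ b.
  by rewrite /ev eval_lin scaleN1r scale1r addrA subrr add0r.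
apply: subfi_lin.
  by rewrite ev_q; apply: subfi_sum => j; case: (pP j) => _ _ _; exact.
apply: small => // [y by0|]; last first.
  rewrite /ev eval_lin; apply: subfi_lin => //.
  by rewrite -/(ev _ _) ev_q; apply: subfi_sum => j; case: (pP j).
(* The coefficients cancel at [x (s J)]; at any other [y], a non-zero [b y] comes from [c (s J)] or
   some [p j], whose other monomials are all smaller. *)
have yx : y != x (s J).
  apply: contraNneq by0 => ->; rewrite /b /q [c (s J) _]cJ mulN1r addrC subr_eq0.
  by apply/eqP/eq_bigr => j _; case: (pP j) => ->.
have [cy|/c_lt] := eqVneq (c (s J) y) 0; last exact.
apply: contrapT => Nlt; case/eqP: by0; rewrite /b cy addr0 /q big1 ?mulr0 // => j _.
have [_ p_lt _ _] := pP j.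
have [->|py] := eqVneq (p j y) 0; first by rewrite mulr0.
by case: Nlt; exact: p_lt.
Qed.

End Noetherianity.

(** * The abelian structure *)

Section AbelianStructure.
Variable R : comPzRingType.
Implicit Types (U V W : FImodule R) (X Y Z : FGFIMod R) (S T : finType).

(** * Addition of natural transformations *)

Lemma fi_app_comp U V W (t : nattrans V W) (s : nattrans U V) S x :
  fi_app (nt_comp t s) S x = fi_app t S (fi_app s S x).
Proof. by []. Qed.

Lemma exists_nattrans_add V W (s t : nattrans V W) : {u : nattrans V W |
  forall S x, fi_app u S x = fi_app s S x + fi_app t S x}.
Proof.
apply: (nattrans_of_linear (t := fun S => fi_app s S \+ fi_app t S)).
by move=> S T f fI x /=; rewrite linearD /= !fi_app_nat.
Qed.

Lemma exists_nattrans_opp V W (s : nattrans V W) : {u : nattrans V W |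
  forall S x, fi_app u S x = - fi_app s S x}.
Proof.
apply: (nattrans_of_linear (t := fun S => \- fi_app s S)).
by move=> S T f fI x /=; rewrite linearN /= !fi_app_nat.
Qed.

Lemma exists_nattrans_zero V W : {u : nattrans V W | forall S x, fi_app u S x = 0}.
Proof.
apply: (nattrans_of_linear (t := fun S => \0)).
by move=> S T f fI x /=; rewrite linear0.
Qed.

Definition nt_add V W (s t : nattrans V W) := sval (exists_nattrans_add s t).
Definition nt_opp V W (s : nattrans V W) := sval (exists_nattrans_opp s).
Definition nt_zero V W := sval (exists_nattrans_zero V W).

Lemma fi_app_add V W (s t : nattrans V W) S x :
  fi_app (nt_add s t) S x = fi_app s S x + fi_app t S x.
Proof. exact: (svalP (exists_nattrans_add s t)). Qed.

Lemma fi_app_opp V W (s : nattrans V W) S x :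
  fi_app (nt_opp s) S x = - fi_app s S x.
Proof. exact: (svalP (exists_nattrans_opp s)). Qed.

Lemma fi_app_zero V W S x : fi_app (nt_zero V W) S x = 0.
Proof. exact: (svalP (exists_nattrans_zero V W)). Qed.

Lemma nt_addA V W : associative (@nt_add V W).
Proof. by move=> s t u; apply: fi_app_eqP => S x; rewrite !fi_app_add addrA. Qed.

Lemma nt_addC V W : commutative (@nt_add V W).
Proof. by move=> s t; apply: fi_app_eqP => S x; rewrite !fi_app_add addrC. Qed.

Lemma nt_add0 V W : left_id (nt_zero V W) (@nt_add V W).
Proof.
by move=> s; apply: fi_app_eqP => S x; rewrite fi_app_add fi_app_zero add0r.
Qed.

Lemma nt_addN V W : left_inverse (nt_zero V W) (@nt_opp V W) (@nt_add V W).
Proof.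
move=> s; apply: fi_app_eqP => S x.
by rewrite fi_app_add fi_app_opp fi_app_zero addNr.
Qed.

Lemma nt_compDl U V W (g g' : nattrans V W) (f : nattrans U V) :
  nt_comp (nt_add g g') f = nt_add (nt_comp g f) (nt_comp g' f).
Proof.
by apply: fi_app_eqP => S x; rewrite fi_app_add !fi_app_comp fi_app_add.
Qed.

Lemma nt_compDr U V W (g : nattrans V W) (f f' : nattrans U V) :
  nt_comp g (nt_add f f') = nt_add (nt_comp g f) (nt_comp g f').
Proof.
by apply: fi_app_eqP => S x; rewrite fi_app_add !fi_app_comp fi_app_add linearD.
Qed.

Definition preadditive_FGFIMod : preadditive (FGFIMod R).
Proof.
refine (@Preadditive (FGFIMod R) (fun X Y => @nt_add (sval X) (sval Y))
  (fun X Y => nt_zero (sval X) (sval Y)) (fun X Y => @nt_opp (sval X) (sval Y))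
  _ _ _ _ _ _).
- by move=> X Y; exact: nt_addA.
- by move=> X Y; exact: nt_addC.
- by move=> X Y; exact: nt_add0.
- by move=> X Y; exact: nt_addN.
- by move=> X Y Z; exact: nt_compDl.
- by move=> X Y Z; exact: nt_compDr.
Defined.

Notation A := preadditive_FGFIMod.

(** * Morphisms by components; pointwise criteria for kernels and cokernels *)

Definition fg_app X Y (f : mor X Y) S :
  {linear fi_space (sval X) S -> fi_space (sval Y) S} :=
  @fi_app R (sval X) (sval Y) f S.

Lemma fg_app_eqP X Y (f g : mor X Y) :
  (forall S x, fg_app f S x = fg_app g S x) -> f = g.
Proof. exact: fi_app_eqP. Qed.

Lemma fg_app_comp X Y Z (g : mor Y Z) (f : mor X Y) S x :
  fg_app (g \mc f) S x = fg_app g S (fg_app f S x).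
Proof. exact: (@fi_app_comp (sval X) (sval Y) (sval Z)). Qed.

Lemma fg_app_zero X Y S x : fg_app (mzero A X Y) S x = 0.
Proof. exact: fi_app_zero. Qed.

Lemma fg_app_add X Y (f g : mor X Y) S x :
  fg_app (madd A f g) S x = fg_app f S x + fg_app g S x.
Proof. exact: fi_app_add. Qed.

Lemma fg_app_nat X Y (f : mor X Y) S T (h : S -> T) (hI : injective h) x :
  fi_map (sval Y) hI (fg_app f S x) = fg_app f T (fi_map (sval X) hI x).
Proof. exact: fi_app_nat. Qed.

(** The factorization is found for each [S] separately; injectivity of [k] then gives both
    naturality and uniqueness. *)
Lemma is_kernel_pointwise X Y K (f : mor X Y) (k : mor K X) :
  (forall S, injective (fg_app k S)) ->
  (forall S, range (fg_app k S) = fg_app f S @^-1` [set 0]) ->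
  is_kernel A f k.
Proof.
move=> k_inj k_range; split.
  apply: fg_app_eqP => S x; rewrite fg_app_comp fg_app_zero.
  have : range (fg_app k S) (fg_app k S x) by exists x.
  by rewrite k_range.
move=> T u fu0.
have lift S : {v : {linear fi_space (sval T) S -> fi_space (sval K) S} |
    fg_app k S \o v =1 fg_app u S}.
  apply: linear_lift => // _ [x _ <-]; rewrite k_range /preimage /=.
  by rewrite -fg_app_comp fu0 fg_app_zero.
have liftE S x : fg_app k S (sval (lift S) x) = fg_app u S x := svalP (lift S) x.
have [|v vE] := @nattrans_of_linear R (sval T) (sval K) (fun S => sval (lift S)).
  move=> S Q h hI x; apply: k_inj.
  by rewrite -fg_app_nat !liftE fg_app_nat.
pose v' : mor T K := v.
have {}vE S x : fg_app v' S x = sval (lift S) x := vE S x.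
exists v'; split.
  by apply: fg_app_eqP => S x; rewrite fg_app_comp vE liftE.
move=> w kw; apply: fg_app_eqP => S x; apply: k_inj.
by rewrite -[RHS]fg_app_comp kw vE liftE.
Qed.

(** Dually, surjectivity of [q] makes the componentwise factorizations natural and unique. *)
Lemma is_cokernel_pointwise X Y Q (f : mor X Y) (q : mor Y Q) :
  (forall S, range (fg_app q S) = setT) ->
  (forall S, fg_app q S @^-1` [set 0] = range (fg_app f S)) ->
  is_cokernel A f q.
Proof.
move=> q_onto q_ker; split.
  apply: fg_app_eqP => S x; rewrite fg_app_comp fg_app_zero.
  suff : (fg_app q S @^-1` [set 0]) (fg_app f S x) by [].
  by rewrite q_ker; exists x.
move=> T u uf0.
have desc S : {v : {linear fi_space (sval Q) S -> fi_space (sval T) S} |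
    v \o fg_app q S =1 fg_app u S}.
  apply: linear_desc => // x qx0.
  have : range (fg_app f S) x by rewrite -q_ker.
  by case=> y _ <-; rewrite -fg_app_comp uf0 fg_app_zero.
have descE S x : sval (desc S) (fg_app q S x) = fg_app u S x := svalP (desc S) x.
have q_ind S (P : fi_space (sval Q) S -> Prop) :
    (forall x, P (fg_app q S x)) -> forall y, P y.
  by move=> Pq y; have : range (fg_app q S) y by [rewrite q_onto]; case=> x _ <-.
have [|v vE] := @nattrans_of_linear R (sval Q) (sval T) (fun S => sval (desc S)).
  move=> S S' h hI; apply: q_ind => x.
  by rewrite fg_app_nat !descE fg_app_nat.
pose v' : mor Q T := v.
have {}vE S x : fg_app v' S x = sval (desc S) x := vE S x.
exists v'; split.
  by apply: fg_app_eqP => S x; rewrite fg_app_comp vE descE.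
move=> w wq; apply: fg_app_eqP => S; apply: q_ind => x.
by rewrite -[RHS]fg_app_comp wq vE descE.
Qed.

(** * Zero object and biproducts *)

Lemma exists_zero_object : exists X, zero_object X.
Proof.
pose Z0 (S : finType) : lmodType R := 'rV[R]_0.
pose m0 S T (h : @mor FI S T) : {linear Z0 S -> Z0 T} := idfun.
have m0M (S T U : FI) (g : mor T U) (f : mor S T) :
    m0 _ _ (g \mc f) = (m0 _ _ g \o m0 _ _ f).
  exact: linear_eqP.
pose Z : FImodule R := @Functor FI (Mod R) Z0 m0 (fun=> erefl) m0M.
have x0 S (x : fi_space Z S) : x = 0 by apply/rowP; case.
have Zfg : finitely_generated_FImodule Z.
  apply/finitely_generatedP; exists set0 => // U _ S x.
  by rewrite [x]x0; exact: subfi0.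
exists (exist _ Z Zfg) => X; split.
  exists (mzero A X _); split=> // f _; apply: fg_app_eqP => S x.
  by rewrite fg_app_zero [RHS]x0.
exists (mzero A _ X); split=> // f _; apply: fg_app_eqP => S x.
by rewrite [x]x0 !linear0.
Qed.

Lemma linear_pair (T U V : lmodType R) (f : {linear T -> U}) (g : {linear T -> V}) :
  {h : {linear T -> (U * V)%type} | forall x, h x = (f x, g x)}.
Proof.
pose h x := (f x, g x).
have h_add : zmod_morphism h by move=> x y; rewrite /h !linearB.
have h_scale : scalable h by move=> a x; rewrite /h !linearZ.
pose hA := GRing.isZmodMorphism.Build _ _ h h_add.
pose hS := GRing.isScalable.Build _ _ _ _ h h_scale.
pose hL : {linear T -> (U * V)%type} := HB.pack h hA hS.
by exists hL.
Qed.

Lemma exists_prod_FImodule V W : {P : FImodule R &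
  {p : (nattrans P V * nattrans P W)%type &
  {i : (nattrans V P * nattrans W P)%type |
    forall S, [/\ forall x, fi_app p.1 S (fi_app i.1 S x) = x,
      forall x, fi_app p.2 S (fi_app i.2 S x) = x,
      forall x, fi_app p.1 S (fi_app i.2 S x) = 0,
      forall x, fi_app p.2 S (fi_app i.1 S x) = 0 &
      forall x, fi_app i.1 S (fi_app p.1 S x) + fi_app i.2 S (fi_app p.2 S x) = x]}}}.
Proof.
pose P (S : finType) : lmodType R := (fi_space V S * fi_space W S)%type.
pose m S T (h : @mor FI S T) : {linear P S -> P T} :=
  sval (linear_pair (fi_map V (svalP h) \o fst) (fi_map W (svalP h) \o snd)).
have mE S T h x : m S T h x = (fi_map V (svalP h) x.1, fi_map W (svalP h) x.2).
  exact: svalP (linear_pair _ _) x.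
have m1 (S : FI) : m _ _ (idmor S) = idfun.
  by apply: linear_eqP => -[x y]; rewrite mE !fi_map1.
have mM (S T Q : FI) (g : mor T Q) (f : mor S T) : m _ _ (g \mc f) = (m _ _ g \o m _ _ f).
  apply: linear_eqP => -[x y]; rewrite /= !mE /=.
  by congr pair; exact: fi_mapM.
pose PF : FImodule R := @Functor FI (Mod R) P m m1 mM.
have PE S T (f : S -> T) (fI : injective f) (x : P S) :
    fi_map PF fI x = (fi_map V fI x.1, fi_map W fI x.2).
  by rewrite [LHS]mE; congr pair; exact: eq_fi_map.
pose in1 S := linear_pair (idfun : {linear fi_space V S -> _})
  (\0 : {linear _ -> fi_space W S}).
pose in2 S := linear_pair (\0 : {linear _ -> fi_space V S})
  (idfun : {linear fi_space W S -> _}).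
have [|i1 i1E] := @nattrans_of_linear R V PF (fun S => sval (in1 S)).
  move=> S T f fI x; rewrite PE !(svalP (in1 _)) /=.
  by rewrite linear0.
have [|i2 i2E] := @nattrans_of_linear R W PF (fun S => sval (in2 S)).
  move=> S T f fI x; rewrite PE !(svalP (in2 _)) /=.
  by rewrite linear0.
have [|p1 p1E] := @nattrans_of_linear R PF V
  (fun S => (fst : {linear P S -> fi_space V S})).
  by move=> S T f fI x; rewrite PE.
have [|p2 p2E] := @nattrans_of_linear R PF W
  (fun S => (snd : {linear P S -> fi_space W S})).
  by move=> S T f fI x; rewrite PE.
exists PF, (p1, p2), (i1, i2) => S /=; split=> x.
- by rewrite p1E i1E (svalP (in1 S)).
- by rewrite p2E i2E (svalP (in2 S)).
- by rewrite p1E i2E (svalP (in2 S)).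
- by rewrite p2E i1E (svalP (in1 S)).
- rewrite p1E p2E i1E i2E (svalP (in1 S)) (svalP (in2 S)) /=.
  by case: x => x y; congr pair; rewrite /= ?addr0 ?add0r.
Qed.

(** The product is generated by the images of both generating sets, since each element is the sum of
    its components. *)
Lemma exists_biproduct X Y : exists (P : FGFIMod R) (i1 : mor X P) (i2 : mor Y P)
  (p1 : mor P X) (p2 : mor P Y), is_biproduct A i1 i2 p1 p2.
Proof.
case: X Y => [V Vfg] [W Wfg].
have [P [[p1 p2] [[i1 i2] ipP]]] := exists_prod_FImodule V W.
have Pfg : finitely_generated_FImodule P.
  move: Vfg Wfg => /finitely_generatedP[X finX XV] /finitely_generatedP[Y finY YW].
  apply/finitely_generatedP.
  pose push U (t : nattrans U P) (z : {n : nat & fi_space U 'I_n}) :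
    {n : nat & fi_space P 'I_n} := existT _ (projT1 z) (fi_app t _ (projT2 z)).
  exists (push V i1 @` X `|` push W i2 @` Y).
    by rewrite finite_setU; split; exact: finite_image.
  move=> U UXY S x; have [_ _ _ _ ip] := ipP S; rewrite -[x]ip.
  apply: subfiD.
    apply: (XV (preim_subFImodule i1 U)) => n z Xz; apply: UXY.
    by left; exists (existT _ n z).
  apply: (YW (preim_subFImodule i2 U)) => n z Yz; apply: UXY.
  by right; exists (existT _ n z).
exists (exist _ P Pfg), i1, i2, p1, p2.
split; apply: fg_app_eqP => S x; have [p1i1 p2i2 p1i2 p2i1 ip] := ipP S.
- exact: p1i1.
- exact: p2i2.
- rewrite fg_app_zero; exact: p1i2.
- rewrite fg_app_zero; exact: p2i1.
- rewrite fg_app_add; exact: ip.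
Qed.

(** * Kernels, cokernels and the abelian axioms over a Noetherian ring *)

Hypothesis HR : noetherian R.

Lemma exists_kernel X Y (f : mor X Y) : exists K (k : mor K X), forall S,
  injective (fg_app k S) /\ range (fg_app k S) = fg_app f S @^-1` [set 0].
Proof.
case: X Y f => [V Vfg] [W Wfg] f.
pose Ker := preim_subFImodule (f : nattrans V W) (zero_subFImodule W).
have [K [k kP]] := exists_functor_sub Ker.
have Kfg : finitely_generated_FImodule K.
  have [X [finX XKer KerX]] := subFImodule_finitely_generated HR Vfg Ker.
  (* Generators of the kernel inside [V] are pulled back along [k]; on [X] a preimage exists, so the
     default 0 is not taken there. *)
  pose pre (z : {n : nat & fi_space V 'I_n}) : {n : nat & fi_space K 'I_n} :=
    existT _ (projT1 z) (xget 0 [set y | fi_app k _ y = projT2 z]).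
  apply/finitely_generatedP; exists (pre @` X); first exact: finite_image.
  move=> U UX S x; have [k_inj k_range] := kP S.
  (* The image of [U] under [k] contains [X], hence [k x]; injectivity of [k] brings [x] back into
     [U]. *)
  have : Ker S (fi_app k S x) by rewrite -k_range; exists x.
  case/(KerX (image_subFImodule k U)) => [n y Xy|y Uy /k_inj <- //].
  have [k_inj_n k_range_n] := kP 'I_n.
  have : range (fi_app k 'I_n) y by rewrite k_range_n; exact: XKer.
  case=> w _ wy; exists w => //; apply: UX; exists (existT _ n y) => //.
  congr existT; apply: k_inj_n; rewrite wy.
  exact: (xgetPex (P := [set u | fi_app k 'I_n u = y]) 0 (ex_intro _ w wy)).
by exists (exist _ K Kfg), k.
Qed.

(** The quotient by the image, which inherits finite generation from the target. *)
Lemma exists_cokernel X Y (f : mor X Y) : exists Q (q : mor Y Q), forall S,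
  range (fg_app q S) = setT /\ fg_app q S @^-1` [set 0] = range (fg_app f S).
Proof.
case: X Y f => [V Vfg] [W Wfg] f.
have [Q [q qP]] :=
  exists_functor_quotient (image_subFImodule (f : nattrans V W) (full_subFImodule V)).
have Qfg : finitely_generated_FImodule Q.
  by apply: (finitely_generated_onto (t := q)) => // S; case: (qP S).
by exists (exist _ Q Qfg), q.
Qed.

(** Tested on the kernel inclusion [k], which is finitely generated and so a legitimate test object:
    [f] kills [k], hence [k] is zero. *)
Lemma monomorphism_injective X Y (f : mor X Y) :
  monomorphism f -> forall S, injective (fg_app f S).
Proof.
move=> f_mono S x y fxy; have [K [k kP]] := exists_kernel f.
have k0 : k = mzero A K X.
  apply: f_mono; apply: fg_app_eqP => T u; rewrite !fg_app_comp fg_app_zero linear0.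
  have [_ k_range] := kP T.
  have : range (fg_app k T) (fg_app k T u) by exists u.
  by rewrite k_range.
have [_ k_range] := kP S; apply/eqP; rewrite -subr_eq0; apply/eqP.
have : (fg_app f S @^-1` [set 0]) (x - y) by rewrite /preimage /= linearB /= fxy subrr.
by rewrite -k_range k0 => -[u _ <-]; exact: fg_app_zero.
Qed.

(** Tested on the cokernel projection, which must vanish although it is onto. *)
Lemma epimorphism_onto X Y (f : mor X Y) :
  epimorphism f -> forall S, range (fg_app f S) = setT.
Proof.
move=> f_epi S; have [Q [q qP]] := exists_cokernel f.
have q0 : q = mzero A Y Q.
  apply: f_epi; apply: fg_app_eqP => T u; rewrite !fg_app_comp fg_app_zero.
  have [_ q_ker] := qP T.
  suff : (fg_app q T @^-1` [set 0]) (fg_app f T u) by [].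
  by rewrite q_ker; exists u.
have [_ <-] := qP S; apply/seteqP; split=> // y _.
by rewrite /preimage /= q0; exact: fg_app_zero.
Qed.

Lemma FGFIMod_abelian_for : abelian_for A.
Proof.
split.
- exact: exists_zero_object.
- exact: exists_biproduct.
- move=> X Y f; split.
    have [K [k kP]] := exists_kernel f; exists K, k.
    by apply: is_kernel_pointwise => S; case: (kP S).
  have [Q [q qP]] := exists_cokernel f; exists Q, q.
  by apply: is_cokernel_pointwise => S; case: (qP S).
(* A monomorphism is the kernel of its cokernel, and below an epimorphism is the cokernel of its
   kernel. *)
- move=> X Y f /monomorphism_injective f_inj.
  have [Q [q qP]] := exists_cokernel f; exists Q, q.
  by apply: is_kernel_pointwise => // S; case: (qP S).
- move=> X Y f /epimorphism_onto f_onto.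
  have [K [k kP]] := exists_kernel f; exists K, k.
  by apply: is_cokernel_pointwise => // S; case: (kP S).
Qed.

End AbelianStructure.

Theorem corollary1p4 (R : comPzRingType) (HR : noetherian R) :
  abelian_category (FGFIMod R).
Proof. by exists (preadditive_FGFIMod R); exact: FGFIMod_abelian_for. Qed.
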